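(* Let $d\ge 4$ and $m=2d$. Then $\gamma^d_m(K^d)=\frac{d-1}{d}$.
   Context: $K^d=\{(x_1,\ldots,x_d)\in\mathbb{R}^d : |x_1|+\cdots+|x_d|\le 1\}$ is the $d$-dimensional crosspolytope. For a convex body $K\subset\mathbb{R}^d$ with non-empty interior and a positive integer $m$, $$\gamma^d_m(K)=\min\Big\{\lambda>0 : \exists\, u_1,\ldots,u_m\in\mathbb{R}^d \text{ such that } K\subseteq\bigcup_{i=1}^m(\lambda K+u_i)\Big\},$$ i.e. the smallest positive $\lambda$ such that $K$ can be covered by $m$ translates of $\lambda K$. *)

(* Defs.v *)
From mathcomp Require Import all_boot all_order all_algebra.
From mathcomp Require Import boolp classical_sets reals.

Set Implicit Arguments.
Unset Strict Implicit.
Unset Printing Implicit Defensive.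

Import Order.TTheory GRing.Theory Num.Theory.
Local Open Scope classical_set_scope.
Local Open Scope ring_scope.

Definition crosspolytope (R : realType) (d : nat) : set 'rV[R]_d :=
  [set x | \sum_(i < d) `|x ord0 i| <= 1].
Arguments crosspolytope : clear implicits.

Definition homothet (R : realType) (d : nat) (lambda : R) (K : set 'rV[R]_d)
    (u : 'rV[R]_d) : set 'rV[R]_d :=
  [set lambda *: x + u | x in K].

Definition covering_ratios (R : realType) (d m : nat) (K : set 'rV[R]_d) :
    set R :=
  [set lambda | 0 < lambda /\
     exists u : 'I_m -> 'rV[R]_d,
       K `<=` \bigcup_(i in [set: 'I_m]) homothet lambda K (u i)].

(* The minimum is the unique element of the set that is also a lower bound of
   it. When there is no minimum the value is 0; as covering ratios are positive,
   [covering_functional m K = v] with [v != 0] entails that the minimum is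
   attained at [v]. *)
Definition covering_functional (R : realType) (d m : nat) (K : set 'rV[R]_d) :
    R :=
  xget 0 (covering_ratios m K `&` lbound (covering_ratios m K)).

(* Main.v *)
Require Import Defs.
From mathcomp Require Import all_boot all_order all_algebra.
From mathcomp Require Import boolp classical_sets reals.
From mathcomp Require Import lra.

Set Implicit Arguments.
Unset Strict Implicit.
Unset Printing Implicit Defensive.

Import Order.TTheory GRing.Theory Num.Theory.
Local Open Scope classical_set_scope.
Local Open Scope ring_scope.

(** The crosspolytope is the unit ball of the l1 norm, so a translate of
    [lambda K] is an l1 ball of radius [lambda], and two points it contains are
    at distance at most [2 lambda].

    Lower bound: the [2 d] vertices together with the centre
    [(1/d, ..., 1/d)] of one facet are [2 d + 1] points of [K] at pairwise
    distance at least [2 (d - 1) / d].  Whenever [2 d] translates cover [K], two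
    of these points share a translate, which forces [(d - 1) / d <= lambda]
    ([covering_ratio_ge_separation]).

    Upper bound: the translates centred at the points [+-(1/d) e_i] suffice.  A
    point [x] of [K] is covered by the translate attached to a coordinate of
    largest absolute value, with the sign of that coordinate: that coordinate
    carries at least the fraction [1/d] of the norm of [x]
    ([crosspolytope_axis_translate]).

    Both halves evaluate the norm of [x - a e_i], which differs from that of [x]
    in one summand only ([l1norm_sub_axis]). *)

Definition l1norm (R : realType) (d : nat) (x : 'rV[R]_d) : R :=
  \sum_(i < d) `|x ord0 i|.

Lemma l1norm_triangle (R : realType) (d : nat) (x y u : 'rV[R]_d) :
  l1norm (x - y) <= l1norm (x - u) + l1norm (y - u).
Proof.
rewrite /l1norm -big_split /=; apply: ler_sum => i _; rewrite !mxE.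
by rewrite [`|y _ _ - _|]distrC ler_distD.
Qed.

Lemma homothet_crosspolytopeP (R : realType) (d : nat) (lambda : R)
    (u x : 'rV[R]_d) :
  0 < lambda ->
  homothet lambda (crosspolytope R d) u x <-> l1norm (x - u) <= lambda.
Proof.
move=> l_gt0; have l1Z (y : 'rV[R]_d) c : l1norm (c *: y) = `|c| * l1norm y.
  by rewrite /l1norm mulr_sumr; apply: eq_bigr => i _; rewrite mxE normrM.
split=> [[y /= Ky <-]|le_xu].
  by rewrite addrK l1Z gtr0_norm // ler_piMr // ltW.
exists (lambda^-1 *: (x - u)); last first.
  by rewrite scalerA divff ?gt_eqF // scale1r subrK.
rewrite /crosspolytope /= -/(l1norm _) l1Z gtr0_norm ?invr_gt0 //.
by rewrite mulrC ler_pdivrMr // mul1r.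
Qed.

Lemma l1norm_sub_axis (R : realType) (d : nat) (x : 'rV[R]_d) (a : R)
    (i : 'I_d) :
  l1norm (x - a *: delta_mx ord0 i) =
  l1norm x - `|x ord0 i| + `|x ord0 i - a|.
Proof.
rewrite /l1norm (bigD1 i) //= [in RHS](bigD1 i) //= !mxE !eqxx mulr1.
rewrite (eq_bigr (fun j => `|x ord0 j|)); first by lra.
by move=> j /negPf ji; rewrite !mxE ji andbF mulr0 subr0.
Qed.

Lemma l1norm_axis (R : realType) (d : nat) (a : R) (i : 'I_d) :
  l1norm (a *: delta_mx ord0 i) = `|a|.
Proof.
rewrite /l1norm (bigD1 i) //= !mxE !eqxx mulr1 big1 ?addr0 //.
by move=> j /negPf ji; rewrite !mxE ji andbF mulr0 normr0.
Qed.

Lemma l1norm_const (R : realType) (d : nat) (a : R) :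
  l1norm (const_mx a : 'rV[R]_d) = d%:R * `|a|.
Proof.
rewrite /l1norm (eq_bigr (fun=> `|a|)) => [|i _]; last by rewrite mxE.
by rewrite sumr_const card_ord mulr_natl.
Qed.

(** By the pigeonhole principle, two of more than [m] points of [K] lie in a
    common translate, whose diameter is [2 lambda]. *)
Lemma covering_ratio_ge_separation (R : realType) (d m : nat) (T : finType)
    (p : T -> 'rV[R]_d) (s lambda : R) :
  (m < #|T|)%N ->
  (forall t, crosspolytope R d (p t)) ->
  (forall t t', t != t' -> s <= l1norm (p t - p t')) ->
  covering_ratios m (crosspolytope R d) lambda -> s <= 2 * lambda.
Proof.
move=> ltmT Kp sep [l_gt0 [u cover]].
have near t : {i : 'I_m | l1norm (p t - u i) <= lambda}.
  apply: cid; have [i _ ?] := cover _ (Kp t).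
  by exists i; apply/homothet_crosspolytopeP.
pose f t := sval (near t).
have /injectivePn[t [t' tt' ftt']] : ~~ injectiveb f.
  by apply/injectiveP => /leq_card; rewrite card_ord leqNgt ltmT.
apply: le_trans (sep _ _ tt') _.
apply: le_trans (l1norm_triangle _ _ (u (f t))) _.
have := svalP (near t); have := svalP (near t').
by rewrite -/(f t) -/(f t') -ftt'; lra.
Qed.

(** Indexing by an option type gives exactly one point more than there are
    vertices, as the pigeonhole argument requires. *)
Definition vertex_or_center (R : realType) (d : nat)
    (t : option ('I_d * bool)) : 'rV[R]_d :=
  if t is Some (i, b) then (-1) ^+ b *: delta_mx ord0 i
  else const_mx d%:R^-1.

Lemma l1norm_vertex_or_center (R : realType) (d : nat)
    (t : option ('I_d * bool)) :
  (0 < d)%N -> l1norm (vertex_or_center R t) = 1.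
Proof.
move=> d_gt0; case: t => [[i b]|] /=; first by rewrite l1norm_axis normr_sign.
by rewrite l1norm_const normfV normr_nat divff // pnatr_eq0 -lt0n.
Qed.

(** One of the two points may be taken to be a vertex [v = +-e_i].  The other,
    [x], has norm [1], so its distance to [v] is [1 - |x_i| + |x_i - v_i|]; this
    is at least [2 (1 - |x_i|)], which is enough for the facet centre and for
    the vertices on other axes.  Only for the antipodal vertex does the sign of
    [x_i] matter. *)
Lemma vertex_or_center_separated (R : realType) (d : nat)
    (t t' : option ('I_d * bool)) :
  (0 < d)%N -> t != t' ->
  2 * (1 - d%:R^-1) <= l1norm (vertex_or_center R t - vertex_or_center R t').
Proof.
move=> d_gt0; have dV_ge0 : 0 <= d%:R^-1 :> R by rewrite invr_ge0.
wlog: t t' / t' != None => [sym tt'|].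
  (* If the second point is the facet centre, the first one is a vertex. *)
  have [t'N|] := eqVneq t' None; last by move=> ?; apply: sym.
  have -> : l1norm (vertex_or_center R t - vertex_or_center R t') =
            l1norm (vertex_or_center R t' - vertex_or_center R t).
    by apply: eq_bigr => i _; rewrite !mxE distrC.
  by apply: sym; [rewrite -t'N | rewrite eq_sym].
case: t' => [[i b]|] // _ tt'.
rewrite [vertex_or_center R (Some _)]/= l1norm_sub_axis.
rewrite l1norm_vertex_or_center //.
have sgn_dist (a : R) : 1 - `|a| <= `|a - (-1) ^+ b|.
  by have := lerB_dist ((-1) ^+ b) a; rewrite normr_sign distrC.
case: t tt' => [[k c]|] /= kc; rewrite mxE; last first.
  by have := sgn_dist d%:R^-1; rewrite (ger0_norm dV_ge0); lra.
rewrite mxE eqxx /=; have [ik|ik] := eqVneq i k; last first.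
  by rewrite mulr0 normr0 sub0r normrN normr_sign; lra.
rewrite mulr1 normr_sign; have {kc}: c != b.
  by apply: contraNneq kc => ->; rewrite ik.
case: b c {sgn_dist} => -[] //= _; rewrite ?expr0 ?expr1.
  by rewrite opprK ger0_norm; lra.
by rewrite ler0_norm; lra.
Qed.

Lemma crosspolytope_axis_translate (R : realType) (d : nat) (x : 'rV[R]_d) :
  (2 <= d)%N -> l1norm x <= 1 ->
  exists i (b : bool),
    l1norm (x - ((-1) ^+ b / d%:R) *: delta_mx ord0 i) <= 1 - d%:R^-1.
Proof.
move=> d_ge2 Kx; have d_gt0 : (0 < d)%N by apply: ltn_trans d_ge2.
have dR_gt0 : 0 < d%:R :> R by rewrite ltr0n.
have [i _ max_i] := @Order.TotalTheory.arg_maxP _ _ _ (Ordinal d_gt0) predT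
  (fun i => `|x ord0 i|) isT.
exists i, (x ord0 i < 0); rewrite l1norm_sub_axis.
set t := `|x ord0 i| in max_i *.
have -> : `|x ord0 i - (-1) ^+ (x ord0 i < 0)%R / d%:R| = `|t - d%:R^-1|.
  by rewrite {1}[x ord0 i]realEsign ?num_real // -mulrBr normrMsign.
have le_dt : l1norm x <= d%:R * t.
  rewrite mulr_natl -[d in leRHS]card_ord -sumr_const.
  by apply: ler_sum => j _; apply: max_i.
have [le_dVt|lt_tdV] := lerP d%:R^-1 t; first by lra.
(* Here the distance is at most [(d - 2) t + 1/d], nondecreasing in [t]. *)
have : (d%:R - 2) * t <= (d%:R - 2) * d%:R^-1.
  by rewrite ler_wpM2l ?subr_ge0 ?ler_nat // ltW.
rewrite !mulrBl divff ?gt_eqF //; lra.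
Qed.

Lemma covering_ratio_axis_translates (R : realType) (d : nat) :
  (2 <= d)%N ->
  covering_ratios (2 * d) (crosspolytope R d) (1 - d%:R^-1).
Proof.
move=> d_ge2; have r_gt0 : 0 < 1 - d%:R^-1 :> R.
  by rewrite subr_gt0 invf_lt1 ?ltr1n ?ltr0n // (ltn_trans _ d_ge2).
have cardT : #|{: 'I_d * bool}| = (2 * d)%N.
  by rewrite card_prod card_ord card_bool mulnC.
split=> //; pose T := ('I_d * bool)%type.
pose u (t : T) : 'rV[R]_d := ((-1) ^+ t.2 / d%:R) *: delta_mx ord0 t.1.
exists (fun k => u (enum_val (cast_ord (esym cardT) k))) => x Kx.
have [i [b le_x]] := crosspolytope_axis_translate d_ge2 Kx.
exists (cast_ord cardT (enum_rank (i, b))) => //.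
by rewrite cast_ordK enum_rankK; apply/homothet_crosspolytopeP.
Qed.

Theorem theorem2 (R : realType) (d m : nat) (hd : (4 <= d)%N)
    (hm : m = (2 * d)%N) :
  covering_functional m (crosspolytope R d) = (d%:R - 1) / d%:R.
Proof.
have d_gt0 : (0 < d)%N by apply: leq_trans hd.
have -> : (d%:R - 1) / d%:R = 1 - d%:R^-1 :> R.
  by rewrite mulrBl mul1r divff // pnatr_eq0 -lt0n.
have in_ratios : covering_ratios m (crosspolytope R d) (1 - d%:R^-1).
  by rewrite hm; apply: covering_ratio_axis_translates; apply: leq_trans hd.
have lower : lbound (covering_ratios m (crosspolytope R d)) (1 - d%:R^-1).
  move=> lambda cov.
  have : 2 * (1 - d%:R^-1) <= 2 * lambda; last by lra.
  apply: (covering_ratio_ge_separation (p := @vertex_or_center R d) _ _ _ cov).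
  - by rewrite card_option card_prod card_ord card_bool hm mulnC.
  - move=> t; rewrite /crosspolytope /= -/(l1norm _).
    by rewrite l1norm_vertex_or_center.
  - by move=> t t'; apply: vertex_or_center_separated.
apply: xget_unique => // y [y_ratio y_lower].
by apply/eqP; rewrite eq_le y_lower //= lower.
Qed.
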